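(* (1) Let $\nu=\sum_{k=1}^m\lambda_k\delta_{a_k}$ be a probability measure with $\lambda_k>0$, $\sum_k\lambda_k=1$ and $a_1<a_2<\cdots<a_m$. For any $b\in\mathbb{R}$, $b\neq0$, the measure $\delta_b\rhd\nu$ has exactly $m$ distinct atoms (and no other mass). Writing $\delta_b\rhd\nu=\sum_{k=1}^m\mu_k\delta_{b_k}$ with $b_1<\cdots<b_m$, the atoms satisfy either $b_1<a_1<b_2<a_2<\cdots<a_{m-1}<b_m<a_m$ or $a_1<b_1<a_2<b_2<\cdots<a_m<b_m$, and the weights are $\mu_i=\frac{\prod_{k=1}^m(b_i-a_k)}{b\prod_{k\neq i}(b_i-b_k)}$. (2) Moreover, if $b$ and $c$ are distinct real numbers, the $2m$ atoms appearing in $\delta_b\rhd\nu$ and $\delta_c\rhd\nu$ are all different.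
   Context: For a probability measure $\mu$ on $\mathbb{R}$, $G_\mu(z)=\int\frac{1}{z-x}d\mu(x)$ on $\mathbb{C}^+$ and $H_\mu=1/G_\mu$. The monotone convolution $\mu\rhd\nu$ is the unique probability measure with $H_{\mu\rhd\nu}=H_\mu\circ H_\nu$. In particular $H_{\delta_b\rhd\nu}=H_\nu-b$. *)

(* Defs.v *)
From HB Require Import structures.
From mathcomp Require Import all_boot all_order all_algebra.
From mathcomp Require Import all_classical all_reals all_analysis.
From mathcomp.real_closed Require Import complex.
Set Implicit Arguments. Unset Strict Implicit. Unset Printing Implicit Defensive.
Import Order.TTheory GRing.Theory Num.Theory.
Local Open Scope ring_scope.
Local Open Scope complex_scope.

(* Cauchy transform G_mu(z) = \int 1/(z - t) dmu(t) of a probability measure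
   on R, for z = x + i y, written out via real and imaginary parts:
   1/(z - t) = ((x - t) - i y) / ((x - t)^2 + y^2). *)
Definition cauchy (R : realType) (mu : probability R R) (z : R[i]) : R[i] :=
  Complex
    (Rintegral mu setT (fun t : R => (complex.Re z - t) / ((complex.Re z - t) ^+ 2 + complex.Im z ^+ 2)))
    (Rintegral mu setT (fun t : R => - complex.Im z / ((complex.Re z - t) ^+ 2 + complex.Im z ^+ 2))).

Definition cauchy_disc (R : realType) (m : nat) (w x : 'I_m -> R) (z : R[i]) : R[i] :=
  \sum_(k < m) (w k)%:C / (z - (x k)%:C).

Definition is_delta_rhd (R : realType) (m : nat) (b : R) (lam a : 'I_m -> R)
  (mu : probability R R) : Prop :=
  forall z : R[i], 0 < complex.Im z ->
    (cauchy mu z)^-1 = (cauchy_disc lam a z)^-1 - b%:C.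

Definition is_disc_measure (R : realType) (m : nat) (w x : 'I_m -> R)
  (mu : probability R R) : Prop :=
  forall A : set R, measurable A ->
    mu A = (\sum_(k < m) (w k)%:E * \d_(x k) A)%E.

(* Main.v *)
Require Import Defs.
From HB Require Import structures.
From mathcomp Require Import all_boot all_order all_algebra.
From mathcomp Require Import all_classical all_reals all_analysis.
From mathcomp.real_closed Require Import complex.
From mathcomp Require Import measurable_realfun lra ring.
Import Order.TTheory GRing.Theory Num.Theory.
Import numFieldNormedType.Exports.
Local Open Scope ring_scope.
Local Open Scope complex_scope.

(* Write G_nu = P / A with A = prod_k (X - a_k) and P = sum_k lam_k prod_(j != k) (X - a_j).
   Then 1 / G_nu - b = (A - b P) / P, so the atoms are the roots of A - b P. The
   sign of this polynomial at the nodes a_k gives one root next to each a_i, on the side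
   determined by the sign of b, and Lagrange interpolation of P at the roots gives the
   partial fraction decomposition, hence the weights.

   A probability measure mu with the resulting transform has mu {x} equal to the limit
   of - y Im G_mu (x + i y) as y -> 0, so it charges each root by at least the
   corresponding weight; as the weights add up to 1 there is no other mass.

   For the second part, an atom of mu at x forces 1 / G_mu (x + i y) to be O(y); two shifts
   of the same function by b <> c cannot both be O(y). *)

(** * Nodal polynomials and interpolation *)

Definition node_poly {F : fieldType} {m : nat} (P : pred 'I_m) (x : 'I_m -> F) :
  {poly F} := \prod_(k < m | P k) ('X - (x k)%:P).

Definition nodal {F : fieldType} {m : nat} (x : 'I_m -> F) : {poly F} :=
  node_poly xpredT x.

(** Numerator of [cauchy_disc w x] over the common denominator [nodal x]; it serves both for the
    original data and for the shifted measure. *)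
Definition residue_poly {F : fieldType} {m : nat} (w x : 'I_m -> F) : {poly F} :=
  \sum_(k < m) w k *: node_poly (predC1 k) x.

Lemma horner_node_poly {F : fieldType} {m : nat} (P : pred 'I_m) (x : 'I_m -> F) (t : F) :
  (node_poly P x).[t] = \prod_(k < m | P k) (t - x k).
Proof. by rewrite /node_poly horner_prod; apply: eq_bigr => j _; rewrite hornerXsubC. Qed.

Lemma size_node_polyC1 {F : fieldType} {m : nat} (x : 'I_m -> F) (k : 'I_m) :
  size (node_poly (predC1 k) x) = m.
Proof.
rewrite /node_poly -big_filter size_prod_XsubC -sum1_size big_filter sum1_card.
by rewrite cardC1 card_ord prednK // (leq_ltn_trans _ (ltn_ord k)).
Qed.

Lemma size_nodal {F : fieldType} {m : nat} (x : 'I_m -> F) : size (nodal x) = m.+1.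
Proof. by rewrite /nodal /node_poly size_prod_XsubC -sum1_size sum1_card card_ord. Qed.

Lemma monic_nodal {F : fieldType} {m : nat} (x : 'I_m -> F) : nodal x \is monic.
Proof. exact: monic_prod_XsubC. Qed.

Lemma size_residue_poly {F : fieldType} {m : nat} (w x : 'I_m -> F) :
  (size (residue_poly w x) <= m)%N.
Proof.
apply: (leq_trans (size_sum _ _ _)); apply/bigmax_leqP => k _.
by apply: (leq_trans (size_scale_leq _ _)); rewrite size_node_polyC1.
Qed.

(** Every summand is a multiple of a monic polynomial of degree [m.-1], so the total mass can be
    read off the numerator. *)
Lemma coef_residue_poly {F : fieldType} {m : nat} (w x : 'I_m -> F) :
  (residue_poly w x)`_m.-1 = \sum_(k < m) w k.
Proof.
rewrite coef_sum; apply: eq_bigr => k _; rewrite coefZ.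
have /monicP : node_poly (predC1 k) x \is monic
  by exact: monic_prod_XsubC.
by rewrite lead_coefE size_node_polyC1 => ->; rewrite mulr1.
Qed.

Lemma residue_poly_node {F : fieldType} {m : nat} (w x : 'I_m -> F) (i : 'I_m) :
  (residue_poly w x).[x i] = w i * \prod_(j < m | j != i) (x i - x j).
Proof.
rewrite horner_sum (bigD1 i) //= big1 ?addr0 => [|k ki].
  by rewrite hornerZ horner_node_poly.
by rewrite hornerZ horner_node_poly (bigD1 i) /= ?subrr ?mul0r ?mulr0 // eq_sym.
Qed.

Lemma nodal_node {F : fieldType} {m : nat} (x : 'I_m -> F) (i : 'I_m) :
  (nodal x).[x i] = 0.
Proof. by rewrite /nodal horner_node_poly (bigD1 i) //= subrr mul0r. Qed.

Lemma residue_poly_off_nodes {F : fieldType} {m : nat} (w x : 'I_m -> F) (t : F) :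
  (forall k, t - x k != 0) ->
  (residue_poly w x).[t] = (nodal x).[t] * \sum_(k < m) w k / (t - x k).
Proof.
move=> tx; rewrite horner_sum mulr_sumr; apply: eq_bigr => k _.
rewrite hornerZ /nodal !horner_node_poly [in RHS](bigD1 k) //=.
by have := tx k; set p := \prod_(_ | _) _ => ?; field.
Qed.

(** The difference has [m] distinct roots but degree below [m]. *)
Lemma poly_eq_on_nodes {F : fieldType} {m : nat} (x : 'I_m -> F) (p q : {poly F}) :
  injective x -> (size (p - q)%R <= m)%N -> (forall i, p.[x i] = q.[x i]) -> p = q.
Proof.
move=> xI pq pqx; apply/eqP; rewrite -subr_eq0; apply/eqP.
apply: (@roots_geq_poly_eq0 _ _ [seq x i | i <- enum 'I_m]).
- by apply/allP => _ /mapP[i _ ->]; rewrite /root hornerD hornerN pqx subrr.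
- by rewrite map_inj_uniq // enum_uniq.
- by rewrite size_map -cardE card_ord.
Qed.

Lemma map_nodal {F G : fieldType} (f : {rmorphism F -> G}) {m : nat} (x : 'I_m -> F) :
  map_poly f (nodal x) = nodal (f \o x).
Proof. exact: map_prod_XsubC. Qed.

Lemma map_residue_poly {F G : fieldType} (f : {rmorphism F -> G}) {m : nat}
  (w x : 'I_m -> F) :
  map_poly f (residue_poly w x) = residue_poly (f \o w) (f \o x).
Proof.
rewrite /residue_poly rmorph_sum; apply: eq_bigr => k _.
by rewrite /= map_polyZ; congr (_ *: _); exact: map_prod_XsubC.
Qed.

(** * Sign changes of the pencil and location of its roots *)

(** Strict betweenness is written as a positive product, which is symmetric in [u] and [v]; both
    signs of [b] can then be treated at once. *)
Lemma poly_ivt_strict {R : rcfType} (p : {poly R}) (u v : R) : p.[u] * p.[v] < 0 ->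
  exists2 y, root p y & 0 < (y - u) * (v - y).
Proof.
wlog uv : u v / u <= v => [H puv|].
  have [|/ltW vu] := leP u v; first by move=> uv; exact: H.
  by have [|y py yuv] := H v u vu; [rewrite mulrC | exists y => //; rewrite mulrC -mulrNN !opprB].
wlog pu : p / p.[u] <= 0 => [H puv|puv].
  have [|/ltW pu] := leP p.[u] 0; first by move=> pu; exact: H.
  have [||y py yuv] := H (- p); rewrite ?hornerN ?oppr_le0 ?mulrNN //.
  by exists y => //; rewrite -rootN.
have pv : 0 <= p.[v] by rewrite leNgt; apply/negP => pv; nra.
have [y /andP[uy yv] py] := poly_ivt uv (introT andP (conj pu pv)).
exists y => //; have /rootP py0 := py.
have yu : y != u by apply: contraTneq puv => <-; rewrite py0 mul0r ltxx.
have yv' : v != y by apply: contraTneq puv => ->; rewrite py0 mulr0 ltxx.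
by apply: mulr_gt0; rewrite subr_gt0 lt_neqAle ?uy ?yv eq_sym ?yu ?yv'.
Qed.

Section Pencil.
Variables (R : rcfType) (m : nat) (lam a : 'I_m -> R) (b : R).
Hypotheses (lam_gt0 : forall k, 0 < lam k) (lam_sum : \sum_(k < m) lam k = 1).
Hypotheses (a_inj : injective a) (b_neq0 : b != 0).

Let Q := nodal a - b *: residue_poly lam a.

Lemma pencil_node (i : 'I_m) :
  Q.[a i] = - (b * lam i * \prod_(j < m | j != i) (a i - a j)).
Proof. by rewrite !hornerE nodal_node residue_poly_node; ring. Qed.

(** The positivity hypothesis says that no other node separates [a i] from [a k], so the products
    over the other nodes agree in sign, while the factors [a i - a k] and [a k - a i] are
    opposite. *)
Lemma pencil_neighbour (i k : 'I_m) : k != i ->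
  (forall j, j != i -> j != k -> 0 < (a i - a j) * (a k - a j)) ->
  Q.[a i] * Q.[a k] < 0.
Proof.
move=> ki pos; rewrite !pencil_node (bigD1 k) //=.
rewrite (bigD1 i (P := fun j => j != k)) 1?eq_sym //=.
have := lam_gt0 i; have := lam_gt0 k.
have : 0 < (\prod_(j < m | (j != i) && (j != k)) (a i - a j)) *
          (\prod_(j < m | (j != k) && (j != i)) (a k - a j)).
  rewrite [X in _ * X](eq_bigl _ _ (fun j => andbC _ _)) -big_split /=.
  by apply: prodr_gt0 => j /andP[]; exact: pos.
set p := \prod_(_ | _) _; set q := \prod_(_ | _) _ => pq lk li.
have aki : a k - a i != 0 by rewrite subr_eq0 (inj_eq a_inj).
rewrite [ltLHS](_ : _ = - (b ^+ 2 * (a k - a i) ^+ 2 * (lam i * lam k) * (p * q))); last by ring.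
rewrite oppr_lt0; apply: mulr_gt0 => //; apply: mulr_gt0; last exact: mulr_gt0.
by apply: mulr_gt0; rewrite exprn_even_gt0.
Qed.

(** At [t] the pencil is [nodal a] times [1 - b * s], with [s] the discrete Cauchy sum. Each
    [b / (t - a k)] is below 1, hence so is their weighted mean [b * s], and the sign is that of
    [nodal a]. *)
Lemma pencil_far (i : 'I_m) (t : R) : (forall k, 1 < (t - a k) / b) ->
  (forall j, j != i -> 0 < (a i - a j) * (t - a j)) -> Q.[a i] * Q.[t] < 0.
Proof.
move=> far pos.
have ta k : t - a k != 0.
  by apply: contraTneq (far k) => ->; rewrite mul0r ltr10.
rewrite pencil_node hornerD hornerN hornerZ residue_poly_off_nodes //.
rewrite /nodal horner_node_poly (bigD1 i (P := xpredT)) //=.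
have : 0 < (\prod_(j < m | j != i) (a i - a j)) * (\prod_(j < m | j != i) (t - a j)).
  by rewrite -big_split; exact: prodr_gt0.
set p := \prod_(_ | _) _; set q := \prod_(_ | _) _ => pq.
have s1 : b * (\sum_(k < m) lam k / (t - a k)) < 1.
  rewrite -lam_sum mulr_sumr; apply: ltr_sum => [|k _].
    by apply/hasP; exists i; rewrite ?mem_index_enum.
  rewrite -[ltRHS]mulr1 mulrCA -invf_div ltr_pM2l //.
  by rewrite invf_lt1 // (lt_trans _ (far k)).
set s := \sum_(_ < _) _ in s1 *.
rewrite [ltLHS](_ : _ = - (lam i * ((t - a i) / b * b ^+ 2) * (1 - b * s) * (p * q))); last by field.
rewrite oppr_lt0; apply: mulr_gt0 => //; apply: mulr_gt0; rewrite ?subr_gt0 //.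
apply: mulr_gt0 => //; apply: mulr_gt0; last by rewrite exprn_even_gt0.
exact: lt_trans (far i).
Qed.

(* The second end point for the intermediate value theorem is the nearest node on
   the b-side of a i or, failing that, a i + 2 b. *)
Lemma pencil_root (i : 'I_m) : exists y, [/\ root Q y, 0 < b * (y - a i) &
  forall j, j != i -> 0 < (y - a j) * (a i - a j)].
Proof.
(* It is enough to find a sign change at some [t] on the [b]-side of [a i] such that every other
   node lies on the opposite side or not before [t]. *)
suff [t [tQ ti tj]] : exists t, [/\ Q.[a i] * Q.[t] < 0, 0 < b * (t - a i) &
    forall j, j != i -> b * (a j - a i) < 0 \/ b * (t - a i) <= b * (a j - a i)].
  have [y Qy yt] := poly_ivt_strict _ _ _ tQ; exists y.
  have [b0|b0] : b < 0 \/ 0 < b by apply/orP; rewrite -neq_lt.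
    move: ti; rewrite !nmulr_rgt0 // => ti.
    have yi : y - a i < 0 by nra.
    have ty : t - y < 0 by rewrite -(nmulr_rgt0 _ yi).
    split=> // j /tj; rewrite nmulr_rlt0 // ler_nM2l // => -[] ?; nra.
  move: ti; rewrite !pmulr_rgt0 // => ti.
  have yi : 0 < y - a i by nra.
  have ty : 0 < t - y by rewrite -(pmulr_rgt0 _ yi).
  split=> // j /tj; rewrite pmulr_rlt0 // ler_pM2l // => -[] ?; nra.
(* Multiplying by [b] orients the line, so the nearest node on the [b]-side is a minimiser of
   [b * (a k - a i)]. *)
case: (pickP (fun k => 0 < b * (a k - a i))) => [k0 k0P|none].
  case: (@arg_minP _ R _ k0 (fun k => 0 < b * (a k - a i)) (fun k => b * (a k - a i)) k0P).
  move=> k kP kmin.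
  have ki : k != i by apply: contraTneq kP => ->; rewrite subrr mulr0 ltxx.
  have dich j : j != i -> b * (a j - a i) < 0 \/ b * (a k - a i) <= b * (a j - a i).
    move=> ji; have [|/kmin|/eqP] := ltgtP (b * (a j - a i)) 0; [by left|by right|].
    by rewrite mulf_eq0 (negPf b_neq0) subr_eq0 (inj_eq a_inj) (negPf ji).
  exists (a k); split => //; apply: pencil_neighbour => // j ji jk.
  have b2 : 0 < b ^+ 2 by rewrite exprn_even_gt0.
  have neq : b * (a j - a i) - b * (a k - a i) != 0.
    by rewrite -mulrBr mulf_neq0 // opprB addrA subrK subr_eq0 (inj_eq a_inj).
  rewrite -(pmulr_rgt0 _ b2) [ltRHS](_ : _ =
    (b * (a j - a i)) * (b * (a j - a i) - b * (a k - a i))); last by ring.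
  have [lt|le] := dich j ji; first by nra.
  apply: mulr_gt0; first exact: lt_le_trans le.
  by rewrite lt_neqAle eq_sym neq subr_ge0.
have b2 : 0 < b ^+ 2 by rewrite exprn_even_gt0.
have neg j : j != i -> b * (a j - a i) < 0.
  move=> ji; rewrite ltNge le_eqVlt none orbF eq_sym mulf_eq0 (negPf b_neq0).
  by rewrite subr_eq0 (inj_eq a_inj) (negPf ji).
(* A shift by [b] alone would give the quotient exactly 1 at [k = i], where [pencil_far] asks for
   more than 1. *)
exists (a i + b *+ 2); split; last by move=> j /neg; left.
  apply: pencil_far => [k|j ji].
    have -> : (a i + b *+ 2 - a k) / b = 2 - b * (a k - a i) / b ^+ 2 by field.
    have : b * (a k - a i) / b ^+ 2 <= 0.
      by rewrite pmulr_lle0 ?invr_gt0 // leNgt none.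
    by lra.
  rewrite -(pmulr_rgt0 _ b2) [ltRHS](_ : _ =
    (b * (a j - a i)) * (b * (a j - a i) - 2 * b ^+ 2)); last by ring.
  by have := neg j ji; nra.
by rewrite addrC addKr mulrnAr -expr2 pmulrn_lgt0.
Qed.

End Pencil.

(** * Partial fractions at the roots of the pencil *)

Lemma size_subr_monic {F : fieldType} (m : nat) (p q : {poly F}) :
  p \is monic -> q \is monic -> size p = m.+1 -> size q = m.+1 ->
  (size (p - q)%R <= m)%N.
Proof.
move=> /monicP pm /monicP qm sp sq; apply/leq_sizeP => j; rewrite leq_eqVlt coefB.
move=> /predU1P[<-|mj]; last by rewrite !nth_default ?subrr ?sp ?sq.
by move: pm qm; rewrite !lead_coefE sp sq /= => -> ->; rewrite subrr.
Qed.

Lemma sub_real_neq0 {R : realType} (z : R[i]) (x : R) :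
  0 < complex.Im z -> z - x%:C != 0.
Proof.
case: z => u v /= v0; rewrite eq_complex /= negb_and oppr0 addr0.
by rewrite (gt_eqF v0) orbT.
Qed.

Lemma cauchy_disc_residue {R : realType} {m : nat} (w x : 'I_m -> R) (z : R[i]) :
  0 < complex.Im z ->
  cauchy_disc w x z = (map_poly (real_complex R) (residue_poly w x)).[z] /
                      (map_poly (real_complex R) (nodal x)).[z].
Proof.
move=> z0; have zx k := sub_real_neq0 z (x k) z0.
rewrite map_nodal map_residue_poly residue_poly_off_nodes // mulrC mulKf //.
by rewrite /nodal horner_node_poly; apply/prodf_neq0 => k _; exact: zx.
Qed.

Lemma Im_cauchy_disc {R : realType} {m : nat} (w x : 'I_m -> R) (z : R[i]) :
  complex.Im (cauchy_disc w x z) =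
  \sum_(k < m) w k * (- complex.Im z / ((complex.Re z - x k) ^+ 2 + complex.Im z ^+ 2)).
Proof.
rewrite /cauchy_disc (big_morph (@complex.Im R) (id1 := 0) (op1 := +%R)) //; last by move=> [? ?] [? ?].
apply: eq_bigr => k _; case: z => u v /=.
by rewrite /= oppr0 addr0 mul0r addr0 mulNr.
Qed.

(** On the upper half-plane every summand has negative imaginary part. *)
Lemma cauchy_disc_neq0 {R : realType} {m : nat} (w x : 'I_m -> R) (z : R[i]) :
  (forall k, 0 < w k) -> (0 < m)%N -> 0 < complex.Im z -> cauchy_disc w x z != 0.
Proof.
case: m w x => // m w x w0 _ z0; apply/eqP => /(congr1 (@complex.Im R)) /eqP.
rewrite Im_cauchy_disc /= -[X in X == _]opprK oppr_eq0 -sumrN gt_eqF //.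
have pos k : 0 < - (w k * (- complex.Im z / ((complex.Re z - x k) ^+ 2 + complex.Im z ^+ 2))).
  rewrite mulNr mulrN opprK mulr_gt0 // divr_gt0 //.
  by rewrite ltr_wpDl ?sqr_ge0 // exprn_gt0.
by rewrite big_ord_recl ltr_wpDr // sumr_ge0 // => k _; exact: ltW.
Qed.

Section PencilRoots.
Variables (R : realType) (m : nat) (lam a : 'I_m -> R) (b : R) (y : 'I_m -> R).
Hypotheses (lam_sum : \sum_(k < m) lam k = 1) (lam_gt0 : forall k, 0 < lam k).
Hypotheses (b_neq0 : b != 0) (y_inj : injective y).
Hypothesis y_root : forall i, root (nodal a - b *: residue_poly lam a) (y i).

(** The residue at [y i] of [residue_poly lam a] over the pencil: the numerator there is [(nodal
    a).[y i] / b], and the product in the denominator is the derivative of [nodal y]. *)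
Let mw i := (\prod_(k < m) (y i - a k)) / (b * \prod_(k < m | k != i) (y i - y k)).

(** Both sides are monic of degree [m] and vanish at the [m] distinct [y i]. *)
Lemma pencil_factor : nodal a - b *: residue_poly lam a = nodal y.
Proof.
apply: (poly_eq_on_nodes y) => // [|i]; last by rewrite nodal_node; exact/rootP.
have sr : (size (b *: residue_poly lam a) < size (nodal a))%N.
  by rewrite size_nodal ltnS (leq_trans (size_scale_leq _ _)) // size_residue_poly.
apply: size_subr_monic; rewrite ?monic_nodal ?size_nodal //.
  rewrite monicE lead_coefDl ?size_polyN //.
  exact: monic_nodal.
by rewrite size_polyDl ?size_polyN // size_nodal.
Qed.

(** At a root of the pencil [nodal a] equals [b] times [residue_poly lam a], so the two sides agree
    at [m] points and have degree below [m]. *)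
Lemma pencil_residue : residue_poly mw y = residue_poly lam a.
Proof.
apply: (poly_eq_on_nodes y) => // [|i].
  by rewrite (leq_trans (size_polyD _ _)) // geq_max size_polyN !size_residue_poly.
have /rootP := y_root i; rewrite hornerD hornerN hornerZ => /subr0_eq.
rewrite residue_poly_node /mw /nodal horner_node_poly /= => ->.
have : \prod_(j < m | j != i) (y i - y j) != 0.
  by apply/prodf_neq0 => j ji; rewrite subr_eq0 (inj_eq y_inj) eq_sym.
by set p := \prod_(_ | _) _ => p0; field; rewrite p0 b_neq0.
Qed.

Lemma pencil_weight_sum : \sum_(k < m) mw k = 1.
Proof. by rewrite -(coef_residue_poly mw y) pencil_residue coef_residue_poly. Qed.

Lemma pencil_transform (z : R[i]) : 0 < complex.Im z ->
  (cauchy_disc mw y z)^-1 = (cauchy_disc lam a z)^-1 - b%:C.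
Proof.
move=> z0.
(* An empty family has total weight 0, not 1. *)
have m0 : (0 < m)%N.
  by rewrite lt0n; apply/eqP => m0; subst m; move: lam_sum; rewrite big_ord0 => /esym/eqP; rewrite oner_eq0.
have := cauchy_disc_neq0 lam a z lam_gt0 m0 z0.
rewrite !cauchy_disc_residue // pencil_residue -pencil_factor mulf_eq0 invr_eq0.
rewrite negb_or => /andP[r0 n0]; rewrite rmorphB /= map_polyZ hornerD hornerN hornerZ.
by rewrite !invf_div mulrBl mulfK.
Qed.

End PencilRoots.

(** * The Poisson kernel and recovery of point masses *)

(* pi * y times the Poisson kernel, so that the value at t = x is 1. *)
Definition poisson {R : realType} (x y t : R) : R := y ^+ 2 / ((x - t) ^+ 2 + y ^+ 2).

Lemma poisson_den_gt0 {R : realType} (x y t : R) : 0 < y -> 0 < (x - t) ^+ 2 + y ^+ 2.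
Proof. by move=> y0; rewrite ltr_wpDl ?sqr_ge0 // exprn_gt0. Qed.

Lemma poisson_ge0 {R : realType} (x y t : R) : 0 <= poisson x y t.
Proof. by rewrite divr_ge0 ?addr_ge0 ?sqr_ge0. Qed.

Lemma poisson_le1 {R : realType} (x y t : R) : 0 < y -> poisson x y t <= 1.
Proof. by move=> y0; rewrite ler_pdivrMr ?poisson_den_gt0 // mul1r lerDr sqr_ge0. Qed.

Lemma poisson_diag {R : realType} (x y : R) : 0 < y -> poisson x y x = 1.
Proof. by move=> y0; rewrite /poisson subrr expr0n add0r divff // expf_neq0 // gt_eqF. Qed.

Lemma measurable_poisson {R : realType} (x y : R) : 0 < y ->
  measurable_fun setT (poisson x y).
Proof.
move=> y0; apply: continuous_measurable_fun => t; apply: cvgM; first exact: cvg_cst.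
apply: cvgV; first by rewrite gt_eqF // poisson_den_gt0.
apply: cvgD; last exact: cvg_cst.
apply: (@cvg_comp _ _ _ (fun u => x - u) (fun v => v ^+ 2)); last exact: exprn_continuous.
by apply: cvgB; [exact: cvg_cst|exact: cvg_id].
Qed.

Lemma integrable_poisson {R : realType} (mu : probability R R) (x y : R) : 0 < y ->
  mu.-integrable setT (EFin \o poisson x y).
Proof.
move=> y0; apply: (@le_integrable _ _ _ mu setT measurableT _ (EFin \o cst 1)).
- by apply/measurable_EFinP; exact: measurable_poisson.
- by move=> t _; rewrite /= lee_fin !ger0_norm ?poisson_ge0 ?poisson_le1.
- exact: finite_measure_integrable_cst.
Qed.

Lemma Rintegral_poisson {R : realType} (mu : probability R R) (x y : R) : 0 < y ->
  Rintegral mu setT (poisson x y) = - (y * complex.Im (Defs.cauchy mu (x +i* y))).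
Proof.
move=> y0; rewrite /Defs.cauchy /=.
rewrite [in RHS](@eq_Rintegral _ _ _ mu _ (fun t => - y^-1 * poisson x y t)); last first.
  move=> t _; have := poisson_den_gt0 x y t y0; rewrite /poisson => /gt_eqF/negbT.
  by set d := _ + _ => d0; field; rewrite d0 gt_eqF.
rewrite [in RHS](@RintegralZl _ _ _ mu setT (poisson x y)) //; last exact: integrable_poisson.
by rewrite mulNr mulrN opprK mulVKf // gt_eqF.
Qed.

(** The kernel is nonnegative and equals 1 at [x], so it dominates the indicator of [x]. *)
Lemma Rintegral_poisson_ge {R : realType} (mu : probability R R) (x y : R) : 0 < y ->
  fine (mu [set x]%classic) <= Rintegral mu setT (poisson x y).
Proof.
move=> y0; have -> : fine (mu [set x]%classic) = Rintegral mu setT (\1_[set x]%classic).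
  by rewrite /Rintegral integral_indic // setIT.
apply: le_Rintegral => //.
- exact: integrable_indic.
- exact: integrable_poisson.
- move=> t _; rewrite -[leRHS]/(poisson x y t).
  case: (boolP (t \in _)) => [|_]; last exact: poisson_ge0.
  by rewrite inE => ->; rewrite poisson_diag.
Qed.

Lemma cvg_poisson {R : realType} (x t : R) :
  (poisson x n.+1%:R^-1 t @[n --> \oo] --> (\1_[set x]%classic t : R))%classic.
Proof.
rewrite indicE; case: (boolP (t \in _)) => [|/negP tx].
  rewrite inE => ->; apply: cvg_near_cst; near=> n; exact: poisson_diag.
have d0 : (x - t) ^+ 2 + 0 != 0 :> R.
  rewrite addr0 sqrf_eq0 subr_eq0; apply/eqP => xt; by apply: tx; rewrite inE /= xt.
suff : (poisson x n.+1%:R^-1 t @[n --> \oo] --> 0 / ((x - t) ^+ 2 + 0))%classic.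
  by rewrite mul0r.
have sq0 : ((n.+1%:R^-1 : R) ^+ 2 @[n --> \oo] --> (0 : R))%classic.
  suff : ((n.+1%:R^-1 : R) ^+ 2 @[n --> \oo] --> (0 ^+ 2 : R))%classic by rewrite expr0n.
  apply: (@cvg_comp _ _ _ (fun n => n.+1%:R^-1) (fun v : R => v ^+ 2)); first exact: cvg_harmonic.
  exact: exprn_continuous.
have den : ((x - t) ^+ 2 + (n.+1%:R^-1 : R) ^+ 2 @[n --> \oo] --> (x - t) ^+ 2 + 0)%classic.
  by apply: cvgD => //; exact: cvg_cst.
by apply: cvgM => //; apply: cvgV.
Unshelve. all: by end_near. Qed.

(** Dominated convergence with the constant 1 as bound, along the heights [1 / (n + 1)]. *)
Lemma cvg_Rintegral_poisson {R : realType} (mu : probability R R) (x : R) :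
  (Rintegral mu setT (poisson x n.+1%:R^-1) @[n --> \oo] --> fine (mu [set x]%classic))%classic.
Proof.
apply: fine_cvg; rewrite fineK ?fin_num_measure //.
have -> : mu [set x]%classic = (\int[mu]_t (\1_[set x]%classic t)%:E)%E.
  by rewrite integral_indic // setIT.
apply: (@dominated_cvg _ _ _ mu setT measurableT
  (fun n t => (poisson x n.+1%:R^-1 t)%:E) _ (cst 1%E)) => //.
- by move=> n; apply/measurable_EFinP; exact: measurable_poisson.
- by move=> t _; apply: cvg_EFin; [exact: nearW|exact: cvg_poisson].
- exact: finite_measure_integrable_cst.
- by move=> n t _; rewrite /= lee_fin ger0_norm ?poisson_ge0 ?poisson_le1.
Qed.

(** * Discrete measures from lower bounds on atoms *)

(** The bounds at the points give domination on every measurable set. Applied to a set and to its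
    complement, with both total masses equal to 1, this leaves only equality. *)
Lemma disc_measure_eq {R : realType} {m : nat} (w x : 'I_m -> R) (mu : probability R R) :
  injective x -> (forall i, 0 <= w i) -> \sum_(i < m) w i = 1 ->
  (forall i, w i <= fine (mu [set x i]%classic)) -> is_disc_measure w x mu.
Proof.
move=> xI w0 w1 wmu.
have le A : measurable A -> (\sum_(k < m) (w k)%:E * \d_(x k) A <= mu A)%E.
  move=> mA; pose F (k : 'I_m) := ([set x k] `&` A)%classic.
  have mF k : measurable (F k) by apply: measurableI.
  have mU : measurable (\big[setU/set0]_(k < m) F k)%classic.
    by apply: bigsetU_measurable.
  (* Distinct points give disjoint traces on [A], so their masses add up inside [A]. *)
  apply: (@le_trans _ _ (mu (\big[setU/set0]_(k < m) F k)%classic)); last first.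
    apply: le_measure; rewrite ?inE //.
    apply: (big_ind (fun B => B `<=` A)%classic) => //.
      by move=> B C BA CA; rewrite subUset.
    by move=> k _; exact: subIsetr.
  rewrite measure_semi_additive_ord //; last first.
    move=> i j _ _ [_ [[-> _] [/xI ->]]] //.
  apply: lee_sum => k _; rewrite diracE.
  case: (boolP (x k \in A)) => [|_]; last by rewrite mule0.
  rewrite inE mule1 => xA; rewrite -[leRHS]fineK ?fin_num_measure // lee_fin.
  by rewrite /F (_ : _ `&` _ = [set x k])%classic //; apply/setIidPl => _ ->.
pose S (A : set R) : R := \sum_(k < m) w k * (x k \in A)%:R.
have SE A : (\sum_(k < m) (w k)%:E * \d_(x k) A)%E = (S A)%:E.
  by rewrite -sumEFin; apply: eq_bigr => k _; rewrite diracE.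
move=> A mA; have := le _ (measurableC mA); have := le A mA.
rewrite !SE probability_setC // -(fineK (fin_num_measure mu A mA)) -EFinB !lee_fin.
have : S A + S (~` A)%classic = 1.
  rewrite -[RHS]w1 -big_split; apply: eq_bigr => k _ /=.
  by rewrite -mulrDr in_setC; case: (_ \in _); rewrite /= ?addr0 ?add0r mulr1.
by move=> SAC SA SC; congr (_%:E); lra.
Qed.

Lemma cauchy_disc_poisson {R : realType} {m : nat} (w x : 'I_m -> R) (t y : R) :
  0 < y ->
  - (y * complex.Im (cauchy_disc w x (t +i* y))) = \sum_(k < m) w k * poisson t y (x k).
Proof.
move=> y0; rewrite Im_cauchy_disc /= mulr_sumr -sumrN; apply: eq_bigr => k _.
by rewrite /poisson; ring.
Qed.

(** Above [x i] the Poisson sum contains the full weight [w i] plus nonnegative terms at every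
    height, so the limit, which is the mass of [x i], is at least [w i]. *)
Lemma cauchy_cauchy_disc_eq {R : realType} {m : nat} (w x : 'I_m -> R) (mu : probability R R) :
  injective x -> (forall i, 0 <= w i) -> \sum_(i < m) w i = 1 ->
  (forall z : R[i], 0 < complex.Im z -> Defs.cauchy mu z = cauchy_disc w x z) ->
  is_disc_measure w x mu.
Proof.
move=> xI w0 w1 muz; apply: disc_measure_eq => // i.
have cv := cvg_Rintegral_poisson mu (x i).
rewrite -(cvg_lim _ cv) //; apply: limr_ge; first exact: cvgP cv.
apply: nearW => n; rewrite Rintegral_poisson // muz //= cauchy_disc_poisson //.
rewrite (bigD1 i) //= poisson_diag // mulr1 lerDl.
by apply: sumr_ge0 => k _; rewrite mulr_ge0 ?poisson_ge0.
Qed.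

(** * Atoms of two different shifts *)

Lemma Re_inv_bound {R : realType} (G : R[i]) (p y : R) : 0 < p -> 0 < y ->
  p <= - (y * complex.Im G) -> `|complex.Re G^-1| <= y / p.
Proof.
case: G => u v /= p0 y0 pv; have v0 : v < 0 by nra.
have d0 : 0 < u ^+ 2 + v ^+ 2 by nra.
rewrite normrM normfV (gtr0_norm d0) ler_pdivrMr // mulrAC ler_pdivlMr //.
have : p * `|u| <= - (y * v) * `|u| by rewrite ler_wpM2r.
have := normr_ge0 u; rewrite -(real_normK (num_real u)); set U := `|u| => U0.
(* This square bounds [- 2 * U * v] by [U ^+ 2 + v ^+ 2]; the factor 2 is not exploited in the final
   bound. *)
have : 0 <= y * (U + v) ^+ 2 by rewrite mulr_ge0 ?sqr_ge0 // ltW.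
nra.
Qed.

(** Above [x] the two reciprocals have real parts bounded by the height over the respective mass,
    yet these real parts always differ by [b - c] in absolute value. *)
Lemma common_atom_shift {R : realType} (H : R[i] -> R[i]) (b c : R)
  (mu1 mu2 : probability R R) (x : R) :
  (forall z, 0 < complex.Im z -> (Defs.cauchy mu1 z)^-1 = H z - b%:C) ->
  (forall z, 0 < complex.Im z -> (Defs.cauchy mu2 z)^-1 = H z - c%:C) ->
  (0 < mu1 [set x]%classic)%E -> (0 < mu2 [set x]%classic)%E -> b = c.
Proof.
move=> H1 H2 a1 a2; apply/eqP; rewrite -subr_eq0 -normr_eq0 -[_ == _]negbK -normr_gt0 normr_id.
apply/negP => bc.
have fin_gt0 (mu : probability R R) : (0 < mu [set x]%classic)%E -> 0 < fine (mu [set x]%classic).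
  by move=> a; rewrite -lte_fin fineK // fin_num_measure.
have p0 := fin_gt0 _ a1; have q0 := fin_gt0 _ a2.
set p := fine _ in p0; set q := fine _ in q0.
have bound y : 0 < y -> `|b - c| <= y * (p^-1 + q^-1).
  move=> y0; have := Rintegral_poisson_ge mu1 x y y0; have := Rintegral_poisson_ge mu2 x y y0.
  rewrite !Rintegral_poisson // => /(Re_inv_bound _ _ _ q0 y0) B2 /(Re_inv_bound _ _ _ p0 y0).
  move: B2; rewrite H1 // H2 //; case: (H _) => u v /=; rewrite mulrDr.
  have -> : b - c = (u - c) - (u - b) by ring.
  by move=> B2 B1; apply: (le_trans (ler_normB _ _)); rewrite addrC lerD.
have s0 : 0 < p^-1 + q^-1 by rewrite addr_gt0 ?invr_gt0.
(* This height makes the bound equal to half of [|b - c|], a contradiction. *)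
have := bound (`|b - c| / 2 / (p^-1 + q^-1)); rewrite divfK ?gt_eqF // => le.
by have := le (divr_gt0 (divr_gt0 bc (ltr0Sn _ 1)) s0); lra.
Qed.

(** * Interlacing, positive weights and the conclusion *)

Lemma strictly_increasing_inj {R : realType} {m : nat} (x : 'I_m -> R) :
  (forall i j : 'I_m, (i < j)%N -> x i < x j) -> injective x.
Proof.
move=> xlt i j; have [/xlt ij|/xlt ij|/val_inj //] := ltngtP i j => eq_x.
- by move: ij; rewrite eq_x ltxx.
- by move: ij; rewrite eq_x ltxx.
Qed.

(** The sign of [b] selects the alternative; the last hypothesis keeps [y i] on the same side of
    every other node as [a i]. *)
Lemma pencil_root_interlace {R : realType} {m : nat} (a y : 'I_m -> R) (b : R) :
  b != 0 -> (forall i j : 'I_m, (i < j)%N -> a i < a j) ->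
  (forall i, 0 < b * (y i - a i)) ->
  (forall i j, j != i -> 0 < (y i - a j) * (a i - a j)) ->
  ((forall i, y i < a i) /\ (forall i j : 'I_m, (i < j)%N -> a i < y j)) \/
  ((forall i, a i < y i) /\ (forall i j : 'I_m, (i < j)%N -> y i < a j)).
Proof.
move=> b_neq0 ha yb ya.
have [b0|b0] : b < 0 \/ 0 < b by apply/orP; rewrite -neq_lt.
  left; split=> [i|i j ij]; first by have := yb i; rewrite nmulr_rgt0 // subr_lt0.
  have ji : i != j by rewrite -(inj_eq val_inj) ltn_eqF.
  by have := ya j i ji; rewrite pmulr_lgt0 ?subr_gt0 // ha.
right; split=> [i|i j ij]; first by have := yb i; rewrite pmulr_rgt0 // subr_gt0.
have ji : j != i by rewrite eq_sym -(inj_eq val_inj) ltn_eqF.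
by have := ya i j ji; rewrite nmulr_lgt0 ?subr_lt0 // ha.
Qed.

(** The factors pair up for each [k] other than [i], leaving [(y i - a i) / b]; completing to a
    square in the denominator shows the sign. *)
Lemma pencil_weight_gt0 {R : realType} {m : nat} (a y : 'I_m -> R) (b : R) (i : 'I_m) :
  b != 0 -> 0 < b * (y i - a i) ->
  (forall k, k != i -> 0 < (y i - a k) * (y i - y k)) ->
  0 < (\prod_(k < m) (y i - a k)) / (b * \prod_(k < m | k != i) (y i - y k)).
Proof.
move=> b_neq0 yb yk; rewrite (bigD1 i) //=.
have : 0 < \prod_(k < m | k != i) ((y i - a k) * (y i - y k)) by exact: prodr_gt0.
rewrite big_split /=; set p := \prod_(_ | _) _; set q := \prod_(_ | _) _ => pq.
have q0 : q != 0 by apply: contraTneq pq => ->; rewrite mulr0 ltxx.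
rewrite [ltRHS](_ : _ = (b * (y i - a i)) * (p * q) / (b * q) ^+ 2); last first.
  by field; rewrite b_neq0 q0.
apply: divr_gt0; first exact: mulr_gt0.
by rewrite exprn_even_gt0 // mulf_neq0.
Qed.

Theorem theorem3p1 (R : realType) (m : nat) (lam a : 'I_m -> R)
  (hlam : forall k, 0 < lam k) (hsum : \sum_(k < m) lam k = 1)
  (ha : forall i j : 'I_m, (i < j)%N -> a i < a j) :
  (forall b : R, b != 0 ->
    exists (bb mw : 'I_m -> R),
      (forall i j : 'I_m, (i < j)%N -> bb i < bb j) /\
      (forall i, 0 < mw i) /\
      (forall i, mw i = (\prod_(k < m) (bb i - a k))
                        / (b * \prod_(k < m | k != i) (bb i - bb k))) /\
      (((forall i, bb i < a i) /\
         (forall i j : 'I_m, nat_of_ord j = i.+1 -> a i < bb j)) \/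
       ((forall i, a i < bb i) /\
         (forall i j : 'I_m, nat_of_ord j = i.+1 -> bb i < a j))) /\
      (* the discrete measure sum_i mw_i delta_{bb_i} satisfies H = H_nu - b *)
      (forall z : R[i], 0 < complex.Im z ->
         (cauchy_disc mw bb z)^-1 = (cauchy_disc lam a z)^-1 - b%:C) /\
      (* and delta_b |> nu is exactly this measure *)
      (forall mu : probability R R, is_delta_rhd b lam a mu ->
         is_disc_measure mw bb mu)) /\
  (forall (b c : R), b != c ->
    forall mu1 mu2 : probability R R,
      is_delta_rhd b lam a mu1 -> is_delta_rhd c lam a mu2 ->
      forall x : R, (0 < mu1 [set x]%classic)%E -> mu2 [set x]%classic = 0%E).
Proof.
split=> [b b_neq0|b c bc mu1 mu2 mu1P mu2P x mu1x]; last first.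
  apply/eqP; rewrite eq_le measure_ge0 andbT leNgt; apply: contra_neqN bc => mu2x.
  exact: common_atom_shift mu1P mu2P mu1x mu2x.
have a_inj := strictly_increasing_inj a ha.
have [y yP] := fin_all_exists (pencil_root _ _ lam a b hlam hsum a_inj b_neq0).
have y_root i : root (nodal a - b *: residue_poly lam a) (y i) by case: (yP i).
have yb i : 0 < b * (y i - a i) by case: (yP i).
have ya i j : j != i -> 0 < (y i - a j) * (a i - a j) by case: (yP i) => _ _; apply.
have inter := pencil_root_interlace a y b b_neq0 ha yb ya.
(* A node separates the two roots: [a i] in the first alternative, [a j] in the second. *)
have y_lt (i j : 'I_m) : (i < j)%N -> y i < y j.
  move=> ij; case: inter => -[h1 h2].
    exact: lt_trans (h1 i) (h2 i j ij).
  exact: lt_trans (h2 i j ij) (h1 j).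
have y_inj := strictly_increasing_inj y y_lt.
pose mw i := (\prod_(k < m) (y i - a k)) / (b * \prod_(k < m | k != i) (y i - y k)).
have mw_gt0 i : 0 < mw i.
  apply: pencil_weight_gt0 => // k ki.
  (* By interlacing, [a k] and [y k] are both below [y i] when [k < i] and both above it when
     [k > i]. *)
  have [lt|lt|/val_inj eq] := ltngtP k i; last by rewrite eq eqxx in ki.
    have yki := y_lt _ _ lt; rewrite pmulr_lgt0 ?subr_gt0 //.
    by case: inter => -[h1 h2]; [exact: h2|exact: lt_trans (h1 k) yki].
  have yik := y_lt _ _ lt; rewrite nmulr_lgt0 ?subr_lt0 //.
  by case: inter => -[h1 h2]; [exact: lt_trans yik (h1 k)|exact: h2].
have transform := pencil_transform R m lam a b y hsum hlam b_neq0 y_inj y_root.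
exists y, mw; split=> //; split=> //; split=> //; split.
  by case: inter => -[h1 h2]; [left|right]; split=> // i j ji; apply: h2; rewrite ji.
split=> // mu muP; apply: cauchy_cauchy_disc_eq => // [i||z z0].
- exact: (ltW (mw_gt0 i)).
- exact: (pencil_weight_sum R m lam a b y).
(* Inversion, with 0 sent to 0, is injective on the whole field, so equal reciprocals give equal
   transforms. *)
- by apply: invr_inj; rewrite muP // -transform.
Qed.
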